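(* Let $H$ be a separable complex Hilbert space, and let $N$ and $M$ be two bounded normal operators on $H$ with cartesian decompositions $N = A+iB$ and $M = C+iD$ respectively. If $\sigma(B) \subset (0,\pi)$ and $\sigma(D)\subset (0,\pi)$, then $$e^M e^N = e^N e^M \Longrightarrow MN = NM.$$
   Context: For a bounded operator $T$ on a complex Hilbert space, $\sigma(T)$ denotes its spectrum and $e^T=\sum_{n\ge 0} T^n/n!$ its exponential. $T$ is normal if $TT^*=T^*T$. The cartesian decomposition of $T$ is the unique expression $T = X+iY$ with $X, Y$ bounded self-adjoint operators, i.e. $X=(T+T^* )/2$ and $Y=(T-T^* )/(2i)$. *)

(* Defs.v *)
From HB Require Import structures.
From mathcomp Require Import all_boot all_order all_algebra.
From mathcomp Require Import all_classical all_reals all_analysis.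
From mathcomp Require Import complex ring lra.

Set Implicit Arguments.
Unset Strict Implicit.
Unset Printing Implicit Defensive.

Import Order.TTheory GRing.Theory Num.Theory.
Import numFieldNormedType.Exports.

Local Open Scope classical_set_scope.
Local Open Scope complex_scope.
Local Open Scope ring_scope.

(* The inner product is linear in its first argument and conjugate-linear in
   the second. The norm and the topology of H are those of the complete normed
   module, so inner_norm makes H a Hilbert space. *)
HB.mixin Record CompleteNormedModule_isHilbert (R : realType) H
    & CompleteNormedModule R[i] H := {
  inner : {dot H for @Num.conj R[i]};
  inner_norm : forall x : H, inner x x = `|x| ^+ 2
}.

#[short(type="hilbertType")]
HB.structure Definition Hilbert (R : realType) :=
  {H of CompleteNormedModule R[i] H & CompleteNormedModule_isHilbert R H}.

Definition separable (T : topologicalType) :=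
  exists2 S : set T, countable S & dense S.

Section RealNorm.
Context {R : realType} {V : normedModType R[i]}.
Implicit Types x y : V.

(* The norm of V is R[i]-valued; rnorm is the same norm with values in R. *)
Definition rnorm (x : V) : R := complex.Re `|x|.

Lemma rnormE x : (rnorm x)%:C = `|x|.
Proof. by rewrite /rnorm RRe_real. Qed.

Lemma rnorm_ge0 x : 0 <= rnorm x.
Proof. by rewrite -ler0c rnormE normr_ge0. Qed.

Lemma rnorm0 : rnorm (0 : V) = 0.
Proof. by rewrite /rnorm normr0. Qed.

Lemma rnormD x y : rnorm (x + y) <= rnorm x + rnorm y.
Proof. by rewrite -lecR rmorphD/= !rnormE ler_normD. Qed.

Lemma rnormZ (a : R[i]) x : rnorm (a *: x) = complex.Re `|a| * rnorm x.
Proof.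
by apply: complexI; rewrite rmorphM/= !rnormE normrZ.
Qed.

End RealNorm.

(* Bounded linear operators on V; they get the ring structure given by
   composition and the norm given by the operator norm. *)
Record bop (R : realType) (V : normedModType R[i]) := Bop {
  bop_fun :> V -> V;
  bop_linear : linear bop_fun;
  bop_bounded : exists M : R, forall x, `|bop_fun x| <= M%:C * `|x| }.

Section BopRing.
Context {R : realType} {V : normedModType R[i]}.
Implicit Types (S T U : bop V) (a b : R[i]) (x y : V).

Lemma bopP S T : S =1 T -> S = T.
Proof.
case: S T => [s ls bs] [t lt bt] /= /funext st; rewrite -{t}st in lt bt *.
by congr Bop; exact: Prop_irrelevance.
Qed.

HB.instance Definition _ T := GRing.isLinear.Build R[i] V V *:%R T (bop_linear T).
HB.instance Definition _ := gen_eqMixin (bop V).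
HB.instance Definition _ := gen_choiceMixin (bop V).

Lemma bop_boundedP T :
  exists2 M : R, 0 <= M & forall x, rnorm (T x) <= M * rnorm x.
Proof.
have [M TM] := bop_bounded T; exists `|M|; rewrite ?normr_ge0// => x.
rewrite (@le_trans _ _ (M * rnorm x))//.
  by rewrite -lecR rmorphM/= !rnormE.
by rewrite ler_wpM2r ?rnorm_ge0// ler_norm.
Qed.

Lemma mk_bounded (f : V -> V) (M : R) :
  (forall x, rnorm (f x) <= M * rnorm x) ->
  exists M : R, forall x, `|f x| <= M%:C * `|x|.
Proof. by move=> h; exists M => x; rewrite -!rnormE -rmorphM/= lecR. Qed.

Definition bop0 : bop V.
Proof.
exists (fun=> 0); first by move=> a x y; rewrite scaler0 addr0.
by apply: (@mk_bounded _ 0) => x; rewrite rnorm0 mul0r.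
Defined.

Definition bop1 : bop V.
Proof.
exists id => //; by apply: (@mk_bounded _ 1) => x; rewrite mul1r.
Defined.

Definition bopD S T : bop V.
Proof.
exists (fun x => S x + T x).
  by move=> a x y; rewrite !linearP scalerDr addrACA.
have [M _ SM] := bop_boundedP S; have [N _ TN] := bop_boundedP T.
apply: (@mk_bounded _ (M + N)) => x.
by rewrite mulrDl (le_trans (rnormD _ _))// lerD.
Defined.

Definition bopZ a T : bop V.
Proof.
exists (fun x => a *: T x).
  by move=> b x y; rewrite linearP scalerDr !scalerA mulrC.
have [M _ TM] := bop_boundedP T.
apply: (@mk_bounded _ (complex.Re `|a| * M)) => x.
by rewrite rnormZ -mulrA ler_wpM2l// -ler0c RRe_real.
Defined.

Definition bopM S T : bop V.
Proof.
exists (S \o T); first by move=> a x y; rewrite /= !linearP.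
have [M M0 SM] := bop_boundedP S; have [N _ TN] := bop_boundedP T.
apply: (@mk_bounded _ (M * N)) => x.
by rewrite (le_trans (SM _))// -mulrA ler_wpM2l.
Defined.

Lemma bopDA : associative bopD.
Proof. by move=> S T U; apply: bopP => x /=; rewrite addrA. Qed.
Lemma bopDC : commutative bopD.
Proof. by move=> S T; apply: bopP => x /=; rewrite addrC. Qed.
Lemma bop0D : left_id bop0 bopD.
Proof. by move=> T; apply: bopP => x /=; rewrite add0r. Qed.
Lemma bopND : left_inverse bop0 (bopZ (-1)) bopD.
Proof. by move=> T; apply: bopP => x /=; rewrite scaleN1r addNr. Qed.
HB.instance Definition _ :=
  GRing.isZmodule.Build (bop V) bopDA bopDC bop0D bopND.

Lemma bopMA : associative bopM.
Proof. by move=> S T U; apply: bopP. Qed.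
Lemma bop1M : left_id bop1 bopM.
Proof. by move=> T; apply: bopP. Qed.
Lemma bopM1 : right_id bop1 bopM.
Proof. by move=> T; apply: bopP. Qed.
Lemma bopMDl : left_distributive bopM bopD.
Proof. by move=> S T U; apply: bopP. Qed.
Lemma bopMDr : right_distributive bopM bopD.
Proof. by move=> S T U; apply: bopP => x /=; rewrite linearD. Qed.
(* Not a nonzero ring when V is trivial, hence pzRingType. *)
HB.instance Definition _ :=
  GRing.Zmodule_isPzRing.Build (bop V) bopMA bop1M bopM1 bopMDl bopMDr.

Lemma bopZA a b T : bopZ a (bopZ b T) = bopZ (a * b) T.
Proof. by apply: bopP => x /=; rewrite scalerA. Qed.
Lemma bop1Z : left_id 1 bopZ.
Proof. by move=> T; apply: bopP => x /=; rewrite scale1r. Qed.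
Lemma bopZDr : right_distributive bopZ +%R.
Proof. by move=> a S T; apply: bopP => x /=; rewrite scalerDr. Qed.
Lemma bopZDl T : {morph bopZ^~ T : a b / a + b}.
Proof. by move=> a b; apply: bopP => x /=; rewrite scalerDl. Qed.
HB.instance Definition _ :=
  GRing.Zmodule_isLmodule.Build R[i] (bop V) bopZA bop1Z bopZDr bopZDl.

Lemma bopDE S T x : (S + T) x = S x + T x. Proof. by []. Qed.
Lemma bopZE a T x : (a *: T) x = a *: T x. Proof. by []. Qed.
Lemma bopME S T x : (S * T) x = S (T x). Proof. by []. Qed.
Lemma bop_0E x : (0 : bop V) x = 0. Proof. by []. Qed.
Lemma bop_1E x : (1 : bop V) x = x. Proof. by []. Qed.
Lemma bopNE T x : (- T) x = - T x.
Proof. by rewrite -[RHS]scaleN1r. Qed.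

Definition opnorm T : R := sup [set rnorm (T x) | x in [set x | rnorm x <= 1]].

Let ball_image T := [set rnorm (T x) | x in [set x | rnorm x <= 1]].

Let has_sup_opnorm T : has_sup (ball_image T).
Proof.
split; first by exists (rnorm (T 0)), 0 => //=; rewrite rnorm0.
have [M M0 TM] := bop_boundedP T; exists M => _ [x /= x1 <-].
by rewrite (le_trans (TM x))// -[leRHS]mulr1 ler_wpM2l.
Qed.

Lemma opnorm_ge0 T : 0 <= opnorm T.
Proof.
apply: (@le_trans _ _ (rnorm (T 0))); first exact: rnorm_ge0.
apply: sup_upper_bound; first exact: has_sup_opnorm.
by exists 0 => //=; rewrite rnorm0.
Qed.

Lemma opnormP T x : rnorm (T x) <= opnorm T * rnorm x.
Proof.
have [x0|x0] := eqVneq (rnorm x) 0.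
  have [M _ TM] := bop_boundedP T.
  by rewrite x0 mulr0 (le_trans (TM x))// x0 mulr0.
have xp : 0 < rnorm x by rewrite lt_def x0 rnorm_ge0.
rewrite -ler_pdivrMr//; apply: sup_upper_bound; first exact: has_sup_opnorm.
have nE : complex.Re `|((rnorm x)^-1)%:C : R[i]| = (rnorm x)^-1.
  by rewrite ger0_norm// ler0c invr_ge0 rnorm_ge0.
exists (((rnorm x)^-1)%:C *: x) => /=; first by rewrite rnormZ nE mulVf.
by rewrite linearZ/= rnormZ nE mulrC.
Qed.

Lemma opnorm_le T (M : R) : 0 <= M ->
  (forall x, rnorm (T x) <= M * rnorm x) -> opnorm T <= M.
Proof.
move=> M0 TM; apply: ge_sup; first by case: (has_sup_opnorm T).
by move=> _ [x /= x1 <-]; rewrite (le_trans (TM x))// -[leRHS]mulr1 ler_wpM2l.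
Qed.

Let normC_ge0 a : 0 <= complex.Re `|a|.
Proof. by rewrite -ler0c RRe_real. Qed.

Lemma opnormD S T : (opnorm (S + T))%:C <= (opnorm S)%:C + (opnorm T)%:C.
Proof.
rewrite -rmorphD/= lecR; apply: opnorm_le => [|x].
  by rewrite addr_ge0 ?opnorm_ge0.
by rewrite bopDE (le_trans (rnormD _ _))// mulrDl lerD// opnormP.
Qed.

Lemma opnormZ a T : (opnorm (a *: T))%:C = `|a| * (opnorm T)%:C.
Proof.
have leZ b U : (opnorm (b *: U))%:C <= `|b| * (opnorm U)%:C.
  rewrite -[`|b|](RRe_real (normr_real b)) -rmorphM lecR; apply: opnorm_le => [|x].
    by rewrite mulr_ge0 ?opnorm_ge0 ?normC_ge0.
  by rewrite bopZE rnormZ -mulrA ler_wpM2l ?normC_ge0 ?opnormP.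
apply/eqP; rewrite eq_le leZ/=.
have [->|a0] := eqVneq a 0; first by rewrite normr0 mul0r ler0c opnorm_ge0.
rewrite mulrC -ler_pdivlMr ?normr_gt0// mulrC -normfV.
by have := leZ a^-1 (a *: T); rewrite scalerA mulVf// scale1r.
Qed.

Lemma opnorm_eq0 T : (opnorm T)%:C = 0 -> T = 0.
Proof.
move=> /complexI T0; apply: bopP => x; have := opnormP T x.
rewrite T0 mul0r bop_0E => Tx0; apply/normr0_eq0; rewrite -rnormE.
by congr (_%:C); apply/eqP; rewrite eq_le Tx0 rnorm_ge0.
Qed.

HB.instance Definition _ :=
  Lmodule_isNormed.Build R[i] (bop V) opnormD opnormZ opnorm_eq0.

Lemma bop_normE T : `|T| = (opnorm T)%:C.
Proof. by []. Qed.

Definition spectrum T : set R[i] :=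
  [set l | ~ exists S, (T - l *: (1 : bop V)) * S = 1 /\
                       S * (T - l *: (1 : bop V)) = 1].

(* The limit is taken for the operator norm. *)
Definition opexp T : bop V :=
  lim (series (fun n => (n`!%:R : R[i])^-1 *: T ^+ n) @ \oo).

End BopRing.

Section Adjoint.
Context {R : realType} {H : hilbertType R}.
Local Notation "'[ x , y ]" := (@inner R H x y).
Implicit Types (x y z u v : H) (a : R[i]).

Lemma innerC u v : '[u, v] = '[v, u]^*.
Proof. by rewrite (hermC (@inner R H)) expr0 mul1r. Qed.
Lemma innerDl u v z : '[u + v, z] = '[u, z] + '[v, z].
Proof. exact: linearDl. Qed.
Lemma innerDr u v z : '[z, u + v] = '[z, u] + '[z, v].
Proof. exact: linearDr. Qed.
Lemma innerZl a u z : '[a *: u, z] = a * '[u, z].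
Proof. by rewrite linearZl_LR. Qed.
Lemma innerZr a u z : '[z, a *: u] = a^* * '[z, u].
Proof. by rewrite linearZr_LR. Qed.
Lemma innerNl u z : '[- u, z] = - '[u, z].
Proof. exact: linearNl. Qed.
Lemma innerNr u z : '[z, - u] = - '[z, u].
Proof. exact: linearNr. Qed.

Lemma inner_proj u v : v != 0 ->
  `|u - ('[u, v] / `|v| ^+ 2) *: v| ^+ 2 =
  `|u| ^+ 2 - `|'[u, v]| ^+ 2 / `|v| ^+ 2.
Proof.
move=> v0; have nv0 : `|v| ^+ 2 != 0 by rewrite expf_eq0/= normr_eq0.
have nvC : (`|v| ^+ 2)^* = `|v| ^+ 2 by rewrite -inner_norm -innerC.
rewrite -[LHS]inner_norm innerDl !innerDr !(innerNl, innerNr, innerZl, innerZr).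
rewrite !rmorphM/= fmorphV/= nvC (innerC v u) normCK !inner_norm.
field. by rewrite normr_eq0.
Qed.

Lemma CauchySchwarz_inner u v : `|'[u, v]| <= `|u| * `|v|.
Proof.
have [->|v0] := eqVneq v 0; first by rewrite linear0r !normr0 mulr0.
rewrite -(@ler_pXn2r _ 2) ?nnegrE ?mulr_ge0// exprMn -ler_pdivrMr; last first.
  by rewrite exprn_gt0// normr_gt0.
by rewrite -subr_ge0 -inner_proj// exprn_ge0.
Qed.

Lemma parallelogram u v :
  `|u + v| ^+ 2 + `|u - v| ^+ 2 = 2 * `|u| ^+ 2 + 2 * `|v| ^+ 2.
Proof. by rewrite -!inner_norm !innerDl !innerDr !(innerNl, innerNr); ring. Qed.

Lemma rparallelogram u v :
  rnorm (u + v) ^+ 2 + rnorm (u - v) ^+ 2 = 2 * rnorm u ^+ 2 + 2 * rnorm v ^+ 2.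
Proof.
have sqE x : `|x| ^+ 2 = (rnorm x ^+ 2)%:C by rewrite rmorphXn/= rnormE.
have twoE (t : R) : 2 * t%:C = (2 * t)%:C by rewrite rmorphM rmorph_nat.
have := parallelogram u v; rewrite !sqE !twoE.
by rewrite -!(rmorphD (real_complex R)) => /complexI.
Qed.

Let ltr0c (r : R) : (0 < r%:C) = (0 < r).
Proof. exact: (ltcR 0 r). Qed.

Let parallelogram_bound (d i a b s t : R) : 0 <= d -> 0 <= i -> i <= 1 ->
  0 <= a -> 0 <= b -> a <= d + i -> b <= d + i -> d *+ 2 <= s ->
  s ^+ 2 + t = 2 * a ^+ 2 + 2 * b ^+ 2 -> t <= (8 * d + 4) * i.
Proof.
move=> d0 i0 i1 a0 b0 ai bi ds st.
have di : 0 <= d + i by rewrite addr_ge0.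
have a2 : a ^+ 2 <= (d + i) ^+ 2 by rewrite ler_pXn2r ?nnegrE.
have b2 : b ^+ 2 <= (d + i) ^+ 2 by rewrite ler_pXn2r ?nnegrE.
have s2 : (d *+ 2) ^+ 2 <= s ^+ 2.
  by rewrite ler_pXn2r ?nnegrE ?mulrn_wge0// (le_trans _ ds)// mulrn_wge0.
have ii : i ^+ 2 <= i by rewrite expr2 ler_piMr.
have dd : (d *+ 2) ^+ 2 = 4 * d ^+ 2 by ring.
have dd' : (d + i) ^+ 2 = d ^+ 2 + 2 * (d * i) + i ^+ 2 by ring.
rewrite mulrDl -mulrA; lra.
Qed.

Lemma cauchy_dist (u : nat -> H) (d : R) : 0 <= d ->
  (forall n m, d *+ 2 <= rnorm (u n + u m)) ->
  (forall n, rnorm (u n) < d + n.+1%:R^-1) -> cvg (u @ \oo).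
Proof.
move=> d0 du ud; apply: cauchy_cvg; apply: cauchy_exP => e e0.
have [r er] : exists r : R, e = r%:C.
  by exists (complex.Re e); rewrite RRe_real// gtr0_real.
move: e0; rewrite {}er ltr0c => r0.
have [N Nr] : exists N : nat, (8 * d + 4) / N.+1%:R < r ^+ 2.
  exists (Num.truncn ((r ^+ 2)^-1 * (8 * d + 4))).
  by rewrite ltr_pdivrMr// -ltr_pdivrMl ?exprn_gt0// truncnS_gt.
exists (u N); exists N => //= n /= Nn.
rewrite -ball_normE /= -rnormE ltcR -(@ltr_pXn2r _ 2) ?nnegrE ?rnorm_ge0 ?ltW//.
apply: le_lt_trans Nr.
have hN := ud N; have hn : rnorm (u n) < d + N.+1%:R^-1.
  by apply: lt_le_trans (ud n) _; rewrite lerD2l lef_pV2 ?posrE// ler_nat ltnS.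
have i0 : (0 : R) <= N.+1%:R^-1 by rewrite invr_ge0.
have i1 : N.+1%:R^-1 <= 1 :> R by rewrite invf_le1// ler1n.
have := rnorm_ge0 (u n); have := rnorm_ge0 (u N).
move=> uN0 un0; exact: (parallelogram_bound d0 i0 i1 uN0 un0 (ltW hN) (ltW hn) (du N n)
  (rparallelogram (u N) (u n))).
Qed.

(* The representing vector is a multiple of the point w of least norm of the
   affine hyperplane F = 1. *)
Lemma riesz (F : {scalar H}) (M : R) :
  (forall x, `|F x| <= M%:C * `|x|) -> exists z, forall x, F x = '[x, z].
Proof.
move=> FM.
have [[x0 fx0]|nf] := pselect (exists x, F x = 1); last first.
  exists 0 => x; rewrite linear0r; apply: contrapT => /eqP fx.
  by apply: nf; exists ((F x)^-1 *: x); rewrite linearZ/= mulVf.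
pose A : set R := [set rnorm x | x in [set x | F x = 1]].
have infA : has_inf A.
  split; first by exists (rnorm x0), x0.
  by exists 0 => _ [x _ <-]; exact: rnorm_ge0.
pose d := inf A.
have dle x : F x = 1 -> d <= rnorm x.
  by move=> fx; apply: ge_inf; [exact: infA.2 | exists x].
have d0 : 0 <= d.
  by apply: lb_le_inf; [exact: infA.1 | move=> _ [x _ <-]; exact: rnorm_ge0].
have /choice[u uP] (n : nat) : exists x, F x = 1 /\ rnorm x < d + n.+1%:R^-1.
  have n0 : (0 : R) < n.+1%:R^-1 by rewrite invr_gt0.
  by have [_ [x fx <-] xd] := inf_adherent n0 infA; exists x.
have /cvg_ex[w uw] : cvg (u @ \oo).
  apply: (@cauchy_dist _ d) => // [n m|n]; last exact: (uP n).2.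
  rewrite -mulr_natr -ler_pdivlMr//.
  have Fnm : F (2^-1 *: (u n + u m)) = 1.
    rewrite linearZ/= [F (_ + _)]linearD/= (uP n).1 (uP m).1.
    by rewrite -[1 + 1]/(2%:R) mulVf ?pnatr_eq0.
  apply: le_trans (dle _ Fnm) _.
  rewrite -lecR rmorphM/= fmorphV rmorph_nat !rnormE normrZ normfV normr_nat.
  by rewrite mulrC.
have uw' (e : R) : 0 < e -> exists n, rnorm (w - u n) < e /\ rnorm (u n) < d + e.
  move=> e0.
  have /cvgrPdist_lt/(_ e%:C) := uw; rewrite ltr0c => /(_ e0)[N _ NP].
  pose n := maxn N (Num.truncn e^-1); exists n; split.
    by rewrite -ltcR rnormE; apply: NP; rewrite /= leq_maxl.
  apply: lt_trans (uP n).2 _; rewrite ltrD2l invf_plt ?posrE//.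
  apply: lt_le_trans (truncnS_gt _) _; by rewrite ler_nat ltnS leq_maxr.
have fw : F w = 1.
  apply/subr0_eq/normr0_eq0; rewrite -[LHS](RRe_real (normr_real _)).
  congr (_%:C); apply/eqP; rewrite eq_le -ler0c RRe_real ?normr_real// normr_ge0 andbT.
  apply/ler_addgt0Pr => e e0; rewrite add0r; have M1 : 0 < `|M| + 1 by rewrite ltr_wpDl.
  have [n [wn _]] := uw' _ (divr_gt0 e0 M1).
  rewrite -lecR RRe_real ?normr_real// -(uP n).1 -linearB (le_trans (FM _))//.
  rewrite -rnormE -rmorphM/= lecR.
  apply: (@le_trans _ _ ((`|M| + 1) * rnorm (w - u n))).
    by rewrite ler_wpM2r ?rnorm_ge0// (le_trans (ler_norm _))// lerDl.
  by rewrite -ler_pdivlMl// mulrC ltW.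
have wd : rnorm w <= d.
  apply/ler_addgt0Pr => e e0; have e2 : 0 < e / 2 by rewrite divr_gt0.
  have [n [wn und]] := uw' _ e2.
  rewrite -(subrK (u n) w) (le_trans (rnormD _ _))//; lra.
have w0 : w != 0.
  by apply: contra_eq_neq fw => ->; rewrite linear0 eq_sym oner_eq0.
have ortho v : F v = 0 -> '[v, w] = 0.
  move=> fv; have [->|v0] := eqVneq v 0; first by rewrite linear0l.
  have := inner_proj w v0; set y := w - _ => yE.
  have : `|w| ^+ 2 <= `|y| ^+ 2.
    rewrite ler_pXn2r ?nnegrE// -!rnormE lecR (le_trans wd)// dle//.
    by rewrite /y linearB/= linearZ/= fv mulr0 subr0.
  rewrite yE lerBrDr gerDl pmulr_lle0 ?invr_gt0 ?exprn_gt0 ?normr_gt0//.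
  rewrite -normrX normr_le0 expf_eq0/= => /eqP wv.
  by rewrite innerC wv rmorph0.
exists ((`|w| ^+ 2)^-1 *: w) => x.
have := ortho (x - F x *: w); rewrite linearB/= linearZ/= fw mulr1 subrr => /(_ erefl).
rewrite innerDl innerNl innerZl inner_norm => /subr0_eq xw.
rewrite innerZr xw fmorphV/=.
have -> : (`|w| ^+ 2)^* = `|w| ^+ 2 by rewrite -inner_norm -innerC.
by rewrite mulrCA mulVf ?mulr1// expf_eq0/= normr_eq0.
Qed.

Lemma adjoint_exists (T : bop H) :
  exists S : bop H, forall x y, '[T x, y] = '[x, S y].
Proof.
have [M M0 TM] := bop_boundedP T.
have TM' x : `|T x| <= M%:C * `|x| by rewrite -!rnormE -rmorphM lecR.
have /choice[S SP] (y : H) : exists z, forall x, '[T x, y] = '[x, z].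
  have lf : scalar (fun x => '[T x, y]).
    by move=> a u v; rewrite linearP innerDl innerZl.
  pose F : {scalar H} :=
    HB.pack (fun x => '[T x, y]) (GRing.isLinear.Build R[i] H R[i] _ _ lf).
  apply: (@riesz F (M * rnorm y)) => x /=.
  rewrite (le_trans (CauchySchwarz_inner _ _))// rmorphM/= rnormE mulrAC.
  by rewrite ler_wpM2r.
have inner_inj u v : (forall x, '[x, u] = '[x, v]) -> u = v.
  move=> uv; apply/subr0_eq/normr0_eq0/eqP; rewrite -sqrf_eq0 -inner_norm.
  by rewrite innerDr innerNr uv subrr.
have linS : linear S.
  move=> a u v; apply: inner_inj => x.
  by rewrite -SP !innerDr !innerZr !SP.
have bndS y : rnorm (S y) <= M * rnorm y.
  have [->|Sy] := eqVneq (rnorm (S y)) 0; first by rewrite mulr_ge0 ?rnorm_ge0.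
  rewrite -(@ler_pM2l _ (rnorm (S y))) ?lt_def ?Sy ?rnorm_ge0//.
  rewrite -lecR !rmorphM/= !rnormE -expr2 -inner_norm -SP.
  have SPr : '[T (S y), y] \is Num.real by rewrite SP inner_norm rpredX ?normr_real.
  rewrite (le_trans (real_ler_norm SPr))// (le_trans (CauchySchwarz_inner _ _))//.
  by rewrite mulrA [`|S y| * _]mulrC ler_wpM2r.
by exists (Bop linS (mk_bounded bndS)).
Qed.

Definition adjoint (T : bop H) : bop H := sval (cid (adjoint_exists T)).

Lemma adjointP (T : bop H) x y : '[T x, y] = '[x, adjoint T y].
Proof. by rewrite /adjoint; case: cid => S /= ->. Qed.

Definition self_adjoint (T : bop H) := adjoint T = T.

Definition normal_op (T : bop H) := T * adjoint T = adjoint T * T.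

(* 'i%C is 0 +i* 1 in R[i]. *)
Definition cartesian_decomposition (T X Y : bop H) :=
  [/\ self_adjoint X, self_adjoint Y & T = X + 'i%C *: Y].

End Adjoint.

(* Main.v *)
Require Import Defs.
From HB Require Import structures.
From mathcomp Require Import all_boot all_order all_algebra.
From mathcomp Require Import all_classical all_reals all_analysis.
From mathcomp Require Import complex.
From mathcomp Require Import ring lra.

(** Everything follows from one assertion, [comm_opexp]: an operator [T]
    commuting with [opexp N] commutes with [N]. Applied to [T = opexp M], it
    gives that [opexp M] commutes with [N]; applied to [M] and [T = N], it gives
    that [N] commutes with [M].

    To prove it, subtract the scalar ['i * pi / 2] from [N], so that the
    imaginary part [B] of [N] has its spectrum in [(- pi / 2, pi / 2)], hence
    norm at most [pi / 2 < 2] because it is self-adjoint ([opnorm_le_spectrum]).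
    Then halve [N] repeatedly. If [T] commutes with [opexp N = V ^+ 2], where
    [V = opexp (N / 2)], the commutator [X = V T - T V] satisfies
    [V X + X V = 0]. Since [A] and [B] commute, [V] equals
    [G * opexp ('i * B / 2) * G] with [G = opexp (A / 4)] self-adjoint and
    invertible, and [opexp ('i * B / 2)] is unitary and close enough to [1] for
    [V] to have a real part bounded below by a positive constant
    ([opexp_accretive]). For such a [V] the equation [V X + X V = 0] has only
    the solution [X = 0] ([sylvester_accretive]), so [T] commutes with [V].
    By induction [T] commutes with [opexp (N / 2 ^ k)] for all [k]; as
    [opexp (N / 2 ^ k) = 1 + N / 2 ^ k + O(4 ^ - k)], it commutes with [N]
    ([comm_opexp_small]).

    The functional equation of the exponential of commuting operators reduces to
    the one for real numbers: the product of two partial sums differs from the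
    partial sum for [S + T] by a sum of terms whose norms are dominated by the
    corresponding real terms ([cauchy_product_gap]). *)

Import Order.TTheory GRing.Theory Num.Theory.
Import numFieldNormedType.Exports.

Local Open Scope classical_set_scope.
Local Open Scope complex_scope.
Local Open Scope ring_scope.

Set Implicit Arguments.
Unset Strict Implicit.
Unset Printing Implicit Defensive.

Lemma pos_realC {R : realType} (e : R[i]) :
  0 < e -> exists2 r : R, 0 < r & e = r%:C.
Proof.
move=> e0; have er : e = (complex.Re e)%:C by rewrite RRe_real// gtr0_real.
by exists (complex.Re e) => //; rewrite -ltcR -er.
Qed.

(** * The operator norm *)

Section OperatorNorm.
Context {R : realType} {V : normedModType R[i]}.
Implicit Types (S T : bop V) (x y : V).

Lemma rnormN x : rnorm (- x) = rnorm x.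
Proof. by rewrite /rnorm normrN. Qed.

Lemma opnormD_le S T : opnorm (S + T) <= opnorm S + opnorm T.
Proof. by have := opnormD S T; rewrite -rmorphD/= lecR. Qed.

Lemma opnormN T : opnorm (- T) = opnorm T.
Proof. by apply: complexI; rewrite -!bop_normE normrN. Qed.

Lemma opnormB_le S T : opnorm (S - T) <= opnorm S + opnorm T.
Proof. by rewrite (le_trans (opnormD_le _ _))// opnormN. Qed.

Lemma opnorm_eq0P T : opnorm T = 0 -> T = 0.
Proof. by move=> T0; apply: opnorm_eq0; rewrite T0. Qed.

Lemma opnorm0 : opnorm (0 : bop V) = 0.
Proof. by apply: complexI; rewrite -bop_normE normr0. Qed.

Lemma opnormZE (a : R[i]) T : opnorm (a *: T) = complex.Re `|a| * opnorm T.
Proof.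
by apply: complexI; rewrite opnormZ -[`|a| in LHS](RRe_real (normr_real a)) -rmorphM.
Qed.

Lemma opnormM_le S T : opnorm (S * T) <= opnorm S * opnorm T.
Proof.
apply: opnorm_le => [|x]; first by rewrite mulr_ge0 ?opnorm_ge0.
rewrite bopME (le_trans (opnormP _ _))// -mulrA ler_wpM2l ?opnorm_ge0//.
exact: opnormP.
Qed.

Lemma opnorm1_le1 : opnorm (1 : bop V) <= 1.
Proof. by apply: opnorm_le => // x; rewrite mul1r. Qed.

Lemma opnormX_le T n : opnorm (T ^+ n) <= opnorm T ^+ n.
Proof.
elim: n => [|n IH]; first by rewrite !expr0 opnorm1_le1.
by rewrite !exprS (le_trans (opnormM_le _ _))// ler_wpM2l ?opnorm_ge0.
Qed.

Lemma opnorm_sum_le (I : Type) (r : seq I) (P : pred I) (F : I -> bop V)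
    (g : I -> R) :
  (forall i, P i -> opnorm (F i) <= g i) ->
  opnorm (\sum_(i <- r | P i) F i) <= \sum_(i <- r | P i) g i.
Proof.
move=> Fg; elim/big_rec2: _ => [|i y1 y2 Pi]; first by rewrite opnorm0.
by move=> IH; rewrite (le_trans (opnormD_le _ _))// lerD// Fg.
Qed.

Lemma bop_scalerAl (a : R[i]) S T : a *: (S * T) = (a *: S) * T.
Proof. by apply: bopP. Qed.

Lemma bop_scalerAr (a : R[i]) S T : a *: (S * T) = S * (a *: T).
Proof. by apply: bopP => x; rewrite bopZE !bopME bopZE linearZ. Qed.

End OperatorNorm.

(** * Limits for the operator norm *)

(** Convergence in operator norm, with the real-valued norm [opnorm]. *)
Definition opcvg {R : realType} {V : normedModType R[i]} (u : nat -> bop V)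
  (L : bop V) : Prop := (fun n => opnorm (u n - L)) @ \oo --> (0 : R).

Section OperatorLimits.
Context {R : realType} {V : normedModType R[i]}.
Implicit Types (u v : nat -> bop V) (L K S T : bop V).

Lemma opcvg_dominated u L (g : nat -> R) :
  (forall n, opnorm (u n - L) <= g n) -> g @ \oo --> (0 : R) -> opcvg u L.
Proof.
move=> ug g0; apply: (@squeeze_cvgr _ _ _ _ (cst 0) g) => //; last exact: cvg_cst.
by apply: nearW => n; rewrite /cst opnorm_ge0 ug.
Qed.

Lemma opcvg_cst T : opcvg (fun=> T) T.
Proof.
by apply: (@opcvg_dominated _ _ (cst 0)) => [n|]; [rewrite subrr opnorm0|exact: cvg_cst].
Qed.

Lemma opcvg_le u L K (b : R) :
  opcvg u L -> (\forall n \near \oo, opnorm (u n - K) <= b) -> opnorm (L - K) <= b.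
Proof.
move=> uL ub; rewrite -[b]addr0.
have cv : (fun n => b + opnorm (u n - L)) @ \oo --> b + 0.
  by apply: cvgD; [exact: cvg_cst|exact: uL].
apply: (@cvgr_to_ge _ \oo _ _ _ _ _ cv).
near=> n; rewrite -(opnormN (u n - L)).
have -> : L - K = (u n - K) + - (u n - L) by rewrite opprB [RHS]addrC subrKA.
by rewrite (le_trans (opnormD_le _ _))// lerD2r; near: n.
Unshelve. all: by end_near. Qed.

Lemma opcvg_unique u L K : opcvg u L -> opcvg u K -> L = K.
Proof.
move=> uL uK; apply/subr0_eq/opnorm_eq0P/eqP; rewrite eq_le opnorm_ge0 andbT.
apply/ler_addgt0Pr => e e0; rewrite add0r; apply: opcvg_le uL _.
have /cvgrPdist_le/(_ e e0) := uK; apply: filterS => n.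
by rewrite sub0r normrN ger0_norm ?opnorm_ge0.
Qed.

Lemma opcvgM u v L K :
  opcvg u L -> opcvg v K -> opcvg (fun n => u n * v n) (L * K).
Proof.
move=> uL vK.
pose g n := opnorm (u n - L) * (opnorm (v n - K) + opnorm K)
            + opnorm L * opnorm (v n - K).
apply: (@opcvg_dominated _ _ g) => [n|]; last first.
  have -> : (0 : R) = 0 * (0 + opnorm K) + opnorm L * 0 by ring.
  apply: cvgD; apply: cvgM => //; [apply: cvgD => //|]; exact: cvg_cst.
have -> : u n * v n - L * K = (u n - L) * v n + L * (v n - K).
  by rewrite mulrBl mulrBr subrKA.
rewrite (le_trans (opnormD_le _ _))// lerD ?opnormM_le//.
rewrite (le_trans (opnormM_le _ _))// ler_wpM2l ?opnorm_ge0//.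
by rewrite -{1}[v n](subrK K) opnormD_le.
Qed.

Lemma opcvg_comm u L T :
  opcvg u L -> (forall n, T * u n = u n * T) -> T * L = L * T.
Proof.
move=> uL Tu; apply: (@opcvg_unique (fun n => T * u n)).
  by apply: opcvgM => //; exact: opcvg_cst.
rewrite (_ : (fun n => _) = (fun n => u n * T)); last by apply/funext.
by apply: opcvgM => //; exact: opcvg_cst.
Qed.

Lemma opcvg_lim u L : opcvg u L -> lim (u @ \oo) = L.
Proof.
move=> uL; apply: cvg_lim; first exact: norm_hausdorff.
apply/cvgrPdist_lt => _ /pos_realC[r r0 ->].
have /cvgrPdist_lt/(_ r r0) := uL; apply: filterS => n.
by rewrite sub0r normrN ger0_norm ?opnorm_ge0// -opnormN opprB bop_normE ltcR.
Qed.

End OperatorLimits.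

(** * Completeness of the space of bounded operators *)

Section Completeness.
Context {R : realType} {V : completeNormedModType R[i]}.

(** Bounded operators form a complete space: the pointwise limit of a Cauchy
    sequence for the operator norm is its limit for that norm. *)
Lemma bop_complete (u : nat -> bop V) :
  (forall e : R, 0 < e -> exists N, forall m n,
    (N <= m)%N -> (N <= n)%N -> opnorm (u m - u n) <= e) ->
  exists L, opcvg u L.
Proof.
move=> uC.
have pw x : cvg ((fun n => u n x) @ \oo).
  apply: cauchy_cvg; apply: cauchy_exP => _ /pos_realC[r r0 ->].
  have x1 : 0 < rnorm x + 1 by rewrite ltr_wpDl ?rnorm_ge0.
  have [N NP] := uC _ (divr_gt0 r0 x1).
  exists (u N x); exists N => //= n /= Nn.
  rewrite -ball_normE /= -rnormE ltcR.
  have -> : u N x - u n x = (u N - u n) x by rewrite bopDE bopNE.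
  apply: (@le_lt_trans _ _ (r / (rnorm x + 1) * rnorm x)).
    by rewrite (le_trans (opnormP _ _))// ler_wpM2r ?rnorm_ge0// NP.
  by rewrite mulrAC ltr_pdivrMr// ltr_pM2l// ltrDl.
pose f x := lim ((fun n => u n x) @ \oo).
have uf x : (fun n => u n x) @ \oo --> f x by exact: pw.
have fbnd e N : (forall m n, (N <= m)%N -> (N <= n)%N -> opnorm (u m - u n) <= e) ->
    forall m x, (N <= m)%N -> rnorm (u m x - f x) <= e * rnorm x.
  move=> NP m x Nm; apply/ler_addgt0Pr => d d0.
  have /cvgrPdist_le/(_ d%:C) := uf x; rewrite (ltcR 0 d) => /(_ d0)[N' _ N'P].
  pose n := maxn N N'.
  have -> : u m x - f x = (u m - u n) x + - (f x - u n x).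
    by rewrite bopDE bopNE opprB subrKA.
  rewrite (le_trans (rnormD _ _))// lerD//.
    by rewrite (le_trans (opnormP _ _))// ler_wpM2r ?rnorm_ge0// NP// leq_maxl.
  by rewrite rnormN -lecR rnormE; apply: N'P; rewrite /= leq_maxr.
have lf : linear f.
  move=> a x y; apply: cvg_lim; first exact: norm_hausdorff.
  rewrite (_ : (fun n => _) = (fun n => a *: u n x + u n y)); last first.
    by apply/funext => n; rewrite linearP.
  apply: cvgD => //; apply: cvgZ => //; exact: cvg_cst.
have [N NP] := uC 1 ltr01.
have bf x : rnorm (f x) <= (opnorm (u N) + 1) * rnorm x.
  have -> : f x = u N x + - (u N x - f x) by rewrite opprB addrC subrK.
  rewrite (le_trans (rnormD _ _))// rnormN mulrDl lerD ?opnormP//.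
  exact: (fbnd 1 N).
exists (Bop lf (mk_bounded bf)); apply/cvgrPdist_le => e e0.
have [N' N'P] := uC e e0; exists N' => //= n /= Nn.
rewrite sub0r normrN ger0_norm ?opnorm_ge0//.
apply: opnorm_le => [|x]; first exact: ltW.
by rewrite bopDE bopNE; exact: (fbnd e N').
Qed.

End Completeness.

(** * The Cauchy product of two series *)

Section Convolution.
Context {K : pzRingType}.

(** If [r] is the Cauchy product of [p] and [q], its partial sums collect the
    products [p i * q j] of a triangle; what is missing to obtain the product of
    the partial sums of [p] and [q] is the rest of the square. *)
Lemma cauchy_product_gap (p q r : nat -> K) n :
  (forall m, r m = \sum_(i < m.+1) p i * q (m - i)%N) ->
  (\sum_(i < n) p i) * (\sum_(j < n) q j) - \sum_(m < n) r m =
  \sum_(i < n) \sum_(j < n | (n <= i + j)%N) p i * q j.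
Proof.
move=> rE.
have -> : \sum_(m < n) r m = \sum_(i < n) \sum_(j < n | (i + j < n)%N) p i * q j.
  transitivity (\sum_(m < n) \sum_(i < n | (i <= m)%N) p i * q (m - i)%N).
    apply: eq_bigr => m _; rewrite rE.
    rewrite (big_ord_widen_cond n xpredT (fun i => p i * q (m - i)%N)) ?ltn_ord//.
  rewrite (exchange_big_dep xpredT)//=; apply: eq_bigr => i _.
  rewrite -(big_mkord (fun m => (i <= m)%N) (fun m => p i * q (m - i)%N)).
  rewrite -(big_mkord (fun j => (i + j < n)%N) (fun j => p i * q j)).
  rewrite -(big_nat_widenl i 0 n xpredT (fun m => p i * q (m - i)%N))//.
  rewrite -{1}[i : nat]add0n big_addn.
  rewrite (big_nat_widen 0 (n - i) n xpredT)//; last exact: leq_subr.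
  apply: eq_big => [j|j _]; last by rewrite addnK.
  by rewrite /= ltn_subRL.
rewrite mulr_suml -sumrB; apply: eq_bigr => i _.
rewrite mulr_sumr (bigID (fun j : 'I_n => (n <= i + j)%N))/= -addrA.
rewrite [X in _ + (X - _)](eq_bigl (fun j : 'I_n => (i + j < n)%N)) ?subrr ?addr0//.
by move=> j; rewrite ltnNge.
Qed.

End Convolution.

Lemma expr_fact_convolution (F : numFieldType) (x y : F) m :
  (m`!%:R)^-1 * (x + y) ^+ m =
  \sum_(i < m.+1) ((i`!%:R)^-1 * x ^+ i) * (((m - i)`!%:R)^-1 * y ^+ (m - i)).
Proof.
rewrite addrC exprDn mulr_sumr; apply: eq_bigr => i _.
have im : (i <= m)%N by rewrite -ltnS.
have /(congr1 (fun k : nat => k%:R : F)) := bin_fact im; rewrite !natrM => <-.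
rewrite -mulr_natr; have := @bin_gt0 m i; rewrite im => b0.
field. by rewrite !pnatr_eq0 -!lt0n !fact_gt0 b0.
Qed.

(** * The exponential of an operator *)

Section Exponential.
Context {R : realType} {V : completeNormedModType R[i]}.
Implicit Types (S T : bop V).

(** The general term of the exponential series. *)
Definition opexp_coeff {W : normedModType R[i]} (T : bop W) (n : nat) : bop W :=
  (n`!%:R : R[i])^-1 *: T ^+ n.

(** The sum of the first [n] terms, up to the exponent [n - 1]; [exp_sum] is
    its analogue for real numbers. *)
Definition opexp_sum {W : normedModType R[i]} (T : bop W) (n : nat) : bop W :=
  \sum_(i < n) opexp_coeff T i.

Definition exp_sum (t : R) (n : nat) : R := \sum_(i < n) (i`!%:R)^-1 * t ^+ i.

Lemma exp_sumE t : exp_sum t = series (exp_coeff t).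
Proof.
by apply/funext => n; rewrite /exp_sum /series/= big_mkord exp_coeffE.
Qed.

Lemma exp_sum_cvg t : exp_sum t @ \oo --> expR t.
Proof. by rewrite exp_sumE; exact: is_cvg_series_exp_coeff. Qed.
Arguments exp_sum_cvg : clear implicits.

Lemma opnorm_coeff T n : opnorm (opexp_coeff T n) <= (n`!%:R)^-1 * opnorm T ^+ n.
Proof.
rewrite /opexp_coeff opnormZE normfV normr_nat.
have -> : complex.Re ((n`!%:R : R[i])^-1) = (n`!%:R)^-1.
  by rewrite -(rmorph_nat (real_complex R)) -fmorphV.
by rewrite ler_wpM2l ?invr_ge0// opnormX_le.
Qed.

Lemma opexp_sum_gap T m n : (m <= n)%N ->
  opnorm (opexp_sum T n - opexp_sum T m) <=
  exp_sum (opnorm T) n - exp_sum (opnorm T) m.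
Proof.
move=> mn; rewrite /opexp_sum /exp_sum -!(big_mkord xpredT (opexp_coeff T)).
rewrite -!(big_mkord xpredT (fun i => (i`!%:R)^-1 * opnorm T ^+ i)).
rewrite [in X in opnorm X](big_cat_nat (leq0n m) mn)//=.
rewrite [in leRHS](big_cat_nat (leq0n m) mn)//=.
rewrite [X in opnorm X]addrC addKr [leRHS]addrC addKr.
by apply: opnorm_sum_le => i _; exact: opnorm_coeff.
Qed.

Lemma exp_sum_ndecr t m n : 0 <= t -> (m <= n)%N -> exp_sum t m <= exp_sum t n.
Proof.
move=> t0 mn; rewrite /exp_sum.
rewrite -!(big_mkord xpredT (fun i => (i`!%:R)^-1 * t ^+ i)).
rewrite (big_cat_nat (leq0n m) mn)//= lerDl.
by rewrite sumr_ge0// => i _; rewrite mulr_ge0 ?invr_ge0 ?exprn_ge0.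
Qed.

Lemma exp_sum_le_expR t n : 0 <= t -> exp_sum t n <= expR t.
Proof.
move=> t0; apply: (cvgr_to_ge (exp_sum_cvg t)).
by exists n => // m /= nm; exact: exp_sum_ndecr.
Qed.

Lemma opexp_cvg T : opcvg (opexp_sum T) (opexp T).
Proof.
have [L uL] : exists L, opcvg (opexp_sum T) L.
  apply: bop_complete => e e0.
  have /cvgrPdist_le/(_ e e0)[N _ NP] := exp_sum_cvg (opnorm T).
  have gap m n : (N <= m)%N -> (m <= n)%N ->
      opnorm (opexp_sum T n - opexp_sum T m) <= e.
    move=> Nm mn; rewrite (le_trans (opexp_sum_gap T mn))//.
    rewrite (le_trans _ (NP m Nm))//= (le_trans _ (ler_norm _))//.
    by rewrite lerD2r exp_sum_le_expR ?opnorm_ge0.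
  exists N => m n Nm Nn; have [mn|/ltnW nm] := leqP m n; last exact: gap.
  by rewrite -opnormN opprB; exact: gap.
suff -> : opexp T = L by [].
rewrite /opexp -(opcvg_lim uL); congr (lim (_ @ \oo)).
by apply/funext => n; rewrite /series/= big_mkord.
Qed.
Arguments opexp_cvg : clear implicits.

Lemma opexp0 : opexp (0 : bop V) = 1.
Proof.
apply: (opcvg_unique (opexp_cvg 0)); apply/cvgrPdist_le => e e0; exists 1%N => //= n.
case: n => // n _; rewrite /opexp_sum big_ord_recl big1 => [|i _].
  by rewrite /opexp_coeff expr0 fact0 invr1 scale1r addr0 subrr opnorm0 subrr normr0 ltW.
by rewrite /opexp_coeff exprS mul0r scaler0.
Qed.

Lemma opexp_coeff_convolution S T m : S * T = T * S ->
  opexp_coeff (S + T) m = \sum_(i < m.+1) opexp_coeff S i * opexp_coeff T (m - i).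
Proof.
move=> ST; rewrite /opexp_coeff addrC exprDn_comm; last by rewrite /GRing.comm.
rewrite scaler_sumr; apply: eq_bigr => i _.
have im : (i <= m)%N by rewrite -ltnS.
have -> : T ^+ (m - i) * S ^+ i = S ^+ i * T ^+ (m - i).
  by apply/commrX/commr_sym/commrX.
rewrite -[_ *+ 'C(m, i)](@scaler_nat R[i]) scalerA.
rewrite -bop_scalerAl -bop_scalerAr scalerA; congr (_ *: _).
have /(congr1 (fun k : nat => k%:R : R[i])) := bin_fact im; rewrite !natrM => <-.
have := @bin_gt0 m i; rewrite im => b0.
field. by rewrite !pnatr_eq0 -!lt0n !fact_gt0 b0.
Qed.

Lemma opexpD S T : S * T = T * S -> opexp (S + T) = opexp S * opexp T.
Proof.
move=> ST; pose s := opnorm S; pose t := opnorm T.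
apply: (opcvg_unique (opexp_cvg (S + T))).
have STcv := opcvgM (opexp_cvg S) (opexp_cvg T).
pose g n := opnorm (opexp_sum S n * opexp_sum T n - opexp S * opexp T)
  + (exp_sum s n * exp_sum t n - exp_sum (s + t) n).
apply: (@opcvg_dominated _ _ _ _ g) => [n|]; last first.
  have -> : (0 : R) = 0 + (expR s * expR t - expR (s + t)).
    by rewrite expRD subrr addr0.
  apply: cvgD => //; apply: cvgB; last exact: exp_sum_cvg.
  by apply: cvgM; exact: exp_sum_cvg.
have -> : opexp_sum (S + T) n - opexp S * opexp T =
    (opexp_sum S n * opexp_sum T n - opexp S * opexp T) +
    - (opexp_sum S n * opexp_sum T n - opexp_sum (S + T) n).
  by rewrite opprB [RHS]addrC subrKA.
rewrite (le_trans (opnormD_le _ _))// lerD2l opnormN.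
rewrite (cauchy_product_gap n (fun m => opexp_coeff_convolution m ST)).
have -> : exp_sum s n * exp_sum t n - exp_sum (s + t) n =
    \sum_(i < n) \sum_(j < n | (n <= i + j)%N)
      ((i`!%:R)^-1 * s ^+ i) * ((j`!%:R)^-1 * t ^+ j).
  apply: (@cauchy_product_gap _ (fun i => (i`!%:R)^-1 * s ^+ i)
    (fun j => (j`!%:R)^-1 * t ^+ j) (fun m => (m`!%:R)^-1 * (s + t) ^+ m)).
  exact: expr_fact_convolution.
apply: opnorm_sum_le => i _; apply: opnorm_sum_le => j _.
rewrite (le_trans (opnormM_le _ _))// ler_pM ?opnorm_ge0 ?opnorm_coeff//.
Qed.

Lemma opexpN_l T : opexp (- T) * opexp T = 1.
Proof. by rewrite -opexpD ?addNr ?opexp0// mulrN mulNr. Qed.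

Lemma opexp_comm S T : S * T = T * S -> S * opexp T = opexp T * S.
Proof.
move=> ST; apply: (opcvg_comm (opexp_cvg T)) => n.
rewrite mulr_sumr mulr_suml; apply: eq_bigr => i _.
by rewrite /opexp_coeff -bop_scalerAl -bop_scalerAr; congr (_ *: _); apply: commrX.
Qed.

Lemma opnorm_opexpB1 T : opnorm (opexp T - 1) <= expR (opnorm T) - 1.
Proof.
apply: (opcvg_le (opexp_cvg T)); exists 1%N => //= n n1.
have E1 : opexp_sum T 1 = 1.
  by rewrite /opexp_sum big_ord1 /opexp_coeff expr0 fact0 invr1 scale1r.
have e1 : exp_sum (opnorm T) 1 = 1.
  by rewrite /exp_sum big_ord1 expr0 fact0 invr1 mul1r.
by have := opexp_sum_gap T n1; rewrite E1 e1 => /le_trans-> //; rewrite lerD2r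
  exp_sum_le_expR ?opnorm_ge0.
Qed.

Lemma opnorm_opexpB1B T :
  opnorm (opexp T - (1 + T)) <= expR (opnorm T) - (1 + opnorm T).
Proof.
apply: (opcvg_le (opexp_cvg T)); exists 2%N => //= n n2.
have E2 : opexp_sum T 2 = 1 + T.
  rewrite /opexp_sum big_ord_recl big_ord1 /opexp_coeff/= expr0 expr1 fact0.
  by rewrite factS fact0 invr1 !scale1r.
have e2 : exp_sum (opnorm T) 2 = 1 + opnorm T.
  rewrite /exp_sum big_ord_recl big_ord1 /= expr0 expr1 fact0.
  by rewrite factS fact0 invr1 !mul1r.
by have := opexp_sum_gap T n2; rewrite E2 e2 => /le_trans-> //; rewrite lerD2r
  exp_sum_le_expR ?opnorm_ge0.
Qed.

End Exponential.

(** * Adjoints and norms on a Hilbert space *)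

Section HilbertSpace.
Context {R : realType} {H : hilbertType R}.
Local Notation "'[ x , y ]" := (@inner R H x y).
Implicit Types (S T U V X A B N : bop H) (x y z : H).

Lemma inner_sqr x : '[x, x] = (rnorm x ^+ 2)%:C.
Proof. by rewrite inner_norm -rnormE -rmorphXn. Qed.

Lemma conj_real (t : R) : (t%:C : R[i])^* = t%:C.
Proof. by apply/eqP; rewrite eq_complex/= oppr0 !eqxx. Qed.

Lemma rnormD_sqr x y :
  rnorm (x + y) ^+ 2 = rnorm x ^+ 2 + 2 * complex.Re '[x, y] + rnorm y ^+ 2.
Proof.
have Re_sqr z : rnorm z ^+ 2 = complex.Re '[z, z] by rewrite inner_sqr.
rewrite !Re_sqr innerDl !innerDr !raddfD/=.
have -> : complex.Re '[y, x] = complex.Re '[x, y].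
  by rewrite innerC; case: ('[x, y]).
by ring.
Qed.

Lemma rnormB_sqr x y :
  rnorm (x - y) ^+ 2 = rnorm x ^+ 2 - 2 * complex.Re '[x, y] + rnorm y ^+ 2.
Proof. by rewrite rnormD_sqr innerNr raddfN/= rnormN mulrN. Qed.

Lemma opnorm_sqr_le T (M : R) : 0 <= M ->
  (forall x, rnorm (T x) ^+ 2 <= M * rnorm x ^+ 2) -> opnorm T ^+ 2 <= M.
Proof.
move=> M0 TM; rewrite -[leRHS]sqr_sqrtr// ler_pXn2r ?nnegrE ?opnorm_ge0 ?sqrtr_ge0//.
apply: opnorm_le => [|x]; first exact: sqrtr_ge0.
by rewrite -(@ler_pXn2r _ 2) ?nnegrE ?mulr_ge0 ?sqrtr_ge0 ?rnorm_ge0// exprMn sqr_sqrtr.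
Qed.

Lemma rnorm_bop_sqr_le T x : rnorm (T x) ^+ 2 <= opnorm T ^+ 2 * rnorm x ^+ 2.
Proof.
by rewrite -exprMn ler_pXn2r ?nnegrE ?mulr_ge0 ?rnorm_ge0 ?opnorm_ge0// opnormP.
Qed.

Lemma adjoint_unique T S : (forall x y, '[T x, y] = '[x, S y]) -> adjoint T = S.
Proof.
move=> TS; apply: bopP => y; apply/subr0_eq/normr0_eq0/eqP.
rewrite -sqrf_eq0 -inner_norm.
set z := _ - _; rewrite {2}/z innerDr innerNr -TS -adjointP subrr//.
Qed.

Lemma adjointD S T : adjoint (S + T) = adjoint S + adjoint T.
Proof.
by apply: adjoint_unique => x y; rewrite !bopDE innerDl innerDr !adjointP.
Qed.

Lemma adjointZ (a : R[i]) T : adjoint (a *: T) = a^* *: adjoint T.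
Proof.
by apply: adjoint_unique => x y; rewrite !bopZE innerZl innerZr adjointP conjCK.
Qed.

Lemma adjointM S T : adjoint (S * T) = adjoint T * adjoint S.
Proof. by apply: adjoint_unique => x y; rewrite !bopME !adjointP. Qed.

Lemma adjoint1 : adjoint (1 : bop H) = 1.
Proof. by apply: adjoint_unique => x y; rewrite !bop_1E. Qed.

Lemma adjoint0 : adjoint (0 : bop H) = 0.
Proof. by apply: adjoint_unique => x y; rewrite !bop_0E linear0l linear0r. Qed.

Lemma adjoint_sum (F : nat -> bop H) n :
  adjoint (\sum_(i < n) F i) = \sum_(i < n) adjoint (F i).
Proof.
elim: n => [|n IH]; first by rewrite !big_ord0 adjoint0.
by rewrite !big_ord_recr /= adjointD IH.
Qed.

Lemma adjointX T n : adjoint (T ^+ n) = adjoint T ^+ n.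
Proof.
by elim: n => [|n IH]; rewrite ?expr0 ?adjoint1// exprS exprSr adjointM IH.
Qed.

Lemma opnorm_adjoint_le T : opnorm (adjoint T) <= opnorm T.
Proof.
apply: opnorm_le => [|x]; first exact: opnorm_ge0.
set y := adjoint T x; have [y0|y0] := eqVneq (rnorm y) 0.
  by rewrite y0 mulr_ge0 ?opnorm_ge0 ?rnorm_ge0.
have yp : 0 < rnorm y by rewrite lt_def y0 rnorm_ge0.
rewrite -(ler_pM2l yp) -expr2 -lecR -inner_sqr {2}/y -adjointP.
have TyR : '[T y, x] \is Num.real by rewrite adjointP inner_norm rpredX ?normr_real.
rewrite (le_trans (real_ler_norm TyR))// (le_trans (CauchySchwarz_inner _ _))//.
rewrite -!rnormE -rmorphM lecR mulrA [rnorm y * _]mulrC.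
by rewrite ler_wpM2r ?rnorm_ge0// opnormP.
Qed.

Lemma adjoint_opexp T : adjoint (opexp T) = opexp (adjoint T).
Proof.
apply: opcvg_unique (opexp_cvg (adjoint T)).
apply: (@opcvg_dominated _ _ _ _ (fun n => opnorm (opexp_sum T n - opexp T))) => [n|];
  last exact: opexp_cvg.
have -> : opexp_sum (adjoint T) n = adjoint (opexp_sum T n).
  rewrite /opexp_sum adjoint_sum; apply: eq_bigr => i _.
  rewrite /opexp_coeff adjointZ adjointX; congr (_ *: _).
  by rewrite fmorphV/= rmorph_nat.
suff -> : adjoint (opexp_sum T n) - adjoint (opexp T) =
    adjoint (opexp_sum T n - opexp T) by exact: opnorm_adjoint_le.
by rewrite adjointD -[- opexp T]scaleN1r adjointZ rmorphN rmorph1 scaleN1r.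
Qed.

(** The exponential of a skew-adjoint operator is unitary. *)
Lemma rnorm_opexp_skew B x : self_adjoint B -> rnorm (opexp ('i%C *: B) x) = rnorm x.
Proof.
move=> sB; apply/eqP; rewrite -(@eqrXn2 _ 2) ?rnorm_ge0//; apply/eqP/complexI.
rewrite -!inner_sqr adjointP adjoint_opexp adjointZ sB.
have -> : ('i%C : R[i])^* = - 'i%C by apply/eqP; rewrite eq_complex/= oppr0 !eqxx.
by rewrite scaleNr -bopME opexpN_l bop_1E.
Qed.

(** * The spectral bound of a self-adjoint operator *)

(** The norm of a self-adjoint operator is attained on its spectrum: if
    neither [s] nor [- s] is spectral for [s = opnorm S], then [S ^+ 2 - s ^+ 2]
    is bounded below, and this forces [opnorm S < s]. *)
Lemma opnorm_le_spectrum S (r : R) : self_adjoint S -> 0 <= r ->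
  (forall l, spectrum S l -> `|l| <= r%:C) -> opnorm S <= r.
Proof.
move=> sS r0 Sr; rewrite leNgt; apply/negP; set s := opnorm S => rs.
have s0 : 0 < s by exact: le_lt_trans rs.
have inv (l : R[i]) : `|l| = s%:C -> exists P, P * (S - l *: (1 : bop H)) = 1.
  move=> ls; apply: contrapT => nP.
  have /Sr : spectrum S l by move=> [P [_ PS]]; apply: nP; exists P.
  by rewrite ls lecR leNgt rs.
have [P PS] : exists P, P * (S - s%:C *: (1 : bop H)) = 1.
  by apply: inv; rewrite ger0_norm// ler0c ltW.
have [Q QS] : exists Q, Q * (S - (- s%:C) *: (1 : bop H)) = 1.
  by apply: inv; rewrite normrN ger0_norm// ler0c ltW.
(* The second summand only serves to make [K * s ^+ 2] at least [1]. *)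
pose K := opnorm (P * Q) + (s ^+ 2)^-1.
have s2 : 0 < s ^+ 2 by rewrite exprn_gt0.
have K0 : 0 < K by rewrite ltr_wpDl ?opnorm_ge0 ?invr_gt0.
have Ks : 1 <= K * s ^+ 2.
  by rewrite mulrDl mulVf ?gt_eqF// lerDr mulr_ge0 ?opnorm_ge0 ?ltW.
have key x : rnorm x ^+ 2 <=
    K ^+ 2 * (s ^+ 2 * (s ^+ 2 * rnorm x ^+ 2 - rnorm (S x) ^+ 2)).
  have xE : x = (P * Q) (S (S x) - (s ^+ 2)%:C *: x).
    have -> : S (S x) - (s ^+ 2)%:C *: x =
        (S - (- s%:C) *: (1 : bop H)) ((S - s%:C *: (1 : bop H)) x).
      have Slin : S (S x - s%:C *: x) = S (S x) - s%:C *: S x.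
        by rewrite linearB/= linearZ.
      rewrite !(bopDE, bopNE, bopZE, bop_1E) Slin scaleNr opprK scalerBr.
      by rewrite scalerA -rmorphM/= -expr2 subrKA.
    rewrite bopME -[Q _]bopME QS bop_1E.
    by rewrite -bopME PS.
  have x_le : rnorm x <= K * rnorm (S (S x) - (s ^+ 2)%:C *: x).
    rewrite {1}xE (le_trans (opnormP _ _))// ler_wpM2r ?rnorm_ge0//.
    by rewrite lerDl invr_ge0 ltW.
  have [K0' y0] := (ltW K0, rnorm_ge0 (S (S x) - (s ^+ 2)%:C *: x)).
  have : rnorm x ^+ 2 <= (K * rnorm (S (S x) - (s ^+ 2)%:C *: x)) ^+ 2.
    by rewrite ler_pXn2r ?nnegrE ?mulr_ge0 ?rnorm_ge0.
  move=> /le_trans; apply; rewrite exprMn ler_wpM2l ?sqr_ge0// rnormB_sqr.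
  have -> : complex.Re '[S (S x), (s ^+ 2)%:C *: x] = s ^+ 2 * rnorm (S x) ^+ 2.
    by rewrite innerZr adjointP sS inner_sqr conj_real -rmorphM.
  have -> : rnorm ((s ^+ 2)%:C *: x) = s ^+ 2 * rnorm x.
    by rewrite rnormZ ger0_norm ?ler0c ?sqr_ge0.
  have := rnorm_bop_sqr_le S (S x); rewrite -/s; lra.
have : s ^+ 2 <= s ^+ 2 - (K ^+ 2 * s ^+ 2)^-1.
  have Ks2 : 0 < K ^+ 2 * s ^+ 2 by rewrite mulr_gt0 ?exprn_gt0.
  apply: opnorm_sqr_le => [|x].
    rewrite subr_ge0 -[leLHS]mul1r ler_pdivrMr//.
    have -> : s ^+ 2 * (K ^+ 2 * s ^+ 2) = (K * s ^+ 2) ^+ 2 by ring.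
    by rewrite exprn_ege1.
  rewrite mulrBl lerBrDr -lerBrDl mulrC ler_pdivrMr// (le_trans (key x))//.
  by rewrite [leRHS]mulrC mulrA.
by rewrite lerDl oppr_ge0 leNgt invr_gt0 mulr_gt0 ?exprn_gt0.
Qed.

(** * Halving exponentials *)

(** If the real part of [V] is bounded below by a positive constant, then the
    spectra of [V] and [- V] lie on opposite sides of the imaginary axis, and
    the Sylvester equation [V X + X V = 0] has only the zero solution. Indeed
    [(l + V) X = X (l - V)], and for a large real [l] the operator [l + V]
    multiplies norms by at least [l], while [l - V] multiplies them by less
    than [l]. *)
Lemma sylvester_accretive V X (c : R) : 0 < c ->
  (forall x, c * rnorm x ^+ 2 <= complex.Re '[V x, x]) ->
  V * X = - (X * V) -> X = 0.
Proof.
move=> c0 Vc VX; set v := opnorm V; have v0 : 0 <= v by exact: opnorm_ge0.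
pose l := (v ^+ 2 + 1) / c + 1.
have l1 : 1 <= l by rewrite lerDr divr_ge0 ?addr_ge0 ?sqr_ge0// ltW.
have lc : l * c = v ^+ 2 + 1 + c by rewrite mulrDl divfK ?gt_eqF// mul1r.
have l0 : 0 < l by exact: lt_le_trans l1.
have l2 : 1 <= l ^+ 2 by rewrite exprn_ege1.
have nl x : rnorm (l%:C *: x) ^+ 2 = l ^+ 2 * rnorm x ^+ 2.
  by rewrite rnormZ ger0_norm ?ler0c ?ltW// exprMn.
have lE x : complex.Re '[V x, l%:C *: x] = l * complex.Re '[V x, x].
  by rewrite innerZr conj_real; case: ('[V x, x]) => a b /=; ring.
have lower x : l ^+ 2 * rnorm x ^+ 2 <= rnorm (V x + l%:C *: x) ^+ 2.
  rewrite rnormD_sqr nl lE lerDr addr_ge0 ?sqr_ge0// mulr_ge0// mulr_ge0 ?(ltW l0)//.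
  by rewrite (le_trans _ (Vc x))// mulr_ge0 ?sqr_ge0// ltW.
have upper x : rnorm (V x - l%:C *: x) ^+ 2 <= (l ^+ 2 - 1) * rnorm x ^+ 2.
  rewrite rnormB_sqr nl lE.
  have h1 := rnorm_bop_sqr_le V x; have x0 := sqr_ge0 (rnorm x).
  have : l * (c * rnorm x ^+ 2) <= l * complex.Re '[V x, x].
    by rewrite ler_wpM2l// ltW.
  rewrite mulrA lc -/v in h1 *; have := mulr_ge0 (sqr_ge0 v) x0.
  have := mulr_ge0 (ltW c0) x0; nra.
have X2 : l ^+ 2 * opnorm X ^+ 2 <= (l ^+ 2 - 1) * opnorm X ^+ 2.
  rewrite mulrC -ler_pdivlMr ?exprn_gt0//; apply: opnorm_sqr_le => [|x].
    by rewrite mulr_ge0 ?invr_ge0 ?sqr_ge0// mulr_ge0 ?sqr_ge0// subr_ge0.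
  rewrite mulrAC ler_pdivlMr ?exprn_gt0// mulrC (le_trans (lower (X x)))//.
  have -> : V (X x) + l%:C *: X x = - X (V x - l%:C *: x).
    by rewrite linearB/= linearZ/= opprB addrC -bopME VX bopNE.
  rewrite rnormN (le_trans (rnorm_bop_sqr_le _ _))//.
  rewrite (le_trans (ler_wpM2l (sqr_ge0 _) (upper x)))//.
  by rewrite mulrA [opnorm X ^+ 2 * _]mulrC.
apply/opnorm_eq0P/eqP; rewrite -sqrf_eq0 eq_le sqr_ge0 andbT.
by move: X2; rewrite mulrBl mul1r; lra.
Qed.

Lemma self_adjointZ (t : R) A : self_adjoint A -> self_adjoint (t%:C *: A).
Proof. by move=> sA; rewrite /self_adjoint adjointZ conj_real sA. Qed.

Lemma opnorm_realZ (t : R) T : 0 <= t -> opnorm (t%:C *: T) = t * opnorm T.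
Proof. by move=> t0; rewrite opnormZE ger0_norm// ler0c. Qed.

Lemma opnorm_iZ T : opnorm ('i%C *: T) = opnorm T.
Proof.
by rewrite opnormZE normc_def/= expr0n expr1n add0r sqrtr1 mul1r.
Qed.

Lemma half_double T : (1 / 2 : R)%:C *: T + (1 / 2 : R)%:C *: T = T.
Proof. by rewrite -scalerDl -rmorphD -splitr scale1r. Qed.

Lemma commZ (a b : R[i]) S T : S * T = T * S -> (a *: S) * (b *: T) = (b *: T) * (a *: S).
Proof.
by move=> ST; rewrite -!bop_scalerAl -!bop_scalerAr !scalerA ST mulrC.
Qed.

(** Write [opexp (A + 'i B) = G * W * G] with [G = opexp (A / 2)] and
    [W = opexp ('i B)]: as [W] is unitary, its real part is controlled by its
    distance to [1], and [G] is self-adjoint and invertible. *)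
Lemma opexp_accretive A B : self_adjoint A -> self_adjoint B -> A * B = B * A ->
  opnorm B <= 1 -> exists2 c : R, 0 < c &
  forall x, c * rnorm x ^+ 2 <= complex.Re '[opexp (A + 'i%C *: B) x, x].
Proof.
move=> sA sB AB B1; pose h : R := 1 / 2.
pose W := opexp ('i%C *: B); pose U := opexp ('i%C *: (h%:C *: B)).
pose G := opexp (h%:C *: A); pose G' := opexp (- (h%:C *: A)).
have WU : W = U * U by rewrite /W /U -opexpD; [rewrite -scalerDr half_double|].
have Ux x : rnorm (U x) = rnorm x := rnorm_opexp_skew x (self_adjointZ h sB).
(* Since [expR (1 / 2) = expR (1 / 8) ^+ 4 <= (8 / 7) ^+ 4], the distance from
   [U] to [1] is less than the inverse of the square root of [2]. *)
have [q [q0 q2 U1]] : exists q : R, [/\ 0 <= q, 2 * q ^+ 2 < 1 & opnorm (U - 1) <= q].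
  have h0 : 0 <= h by rewrite /h; lra.
  have e8 : expR (1 / 8 : R) <= 8 / 7.
    have := expR_ge1Dx (- (1 / 8) : R); rewrite expRN => e8.
    rewrite -[leLHS]invrK -[leRHS]invrK lef_pV2 ?posrE ?invr_gt0 ?expR_gt0//; lra.
  exists ((8 / 7) ^+ 4 - 1); split; [lra|lra|].
  rewrite (le_trans (opnorm_opexpB1 _))// opnorm_iZ opnorm_realZ// lerD2r.
  have e87 : 0 <= 8 / 7 :> R by lra.
  have hB : h * opnorm B <= 4%:R * (1 / 8).
    have -> : 4%:R * (1 / 8) = h * 1 :> R by rewrite /h; lra.
    by rewrite ler_wpM2l.
  rewrite (le_trans (y := expR (4%:R * (1 / 8))))//; first by rewrite ler_expR.
  by rewrite expRM_natl ler_pXn2r ?nnegrE ?expR_ge0.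
have W1 y : rnorm (W y - y) <= (2 * q) * rnorm y.
  have -> : W y - y = (U - 1) (U y) + (U - 1) y.
    by rewrite WU !(bopDE, bopNE, bopME, bop_1E) subrKA.
  rewrite (le_trans (rnormD _ _))// -mulrA mulr2n mulrDl mul1r.
  by rewrite lerD// (le_trans (opnormP _ _))// ?Ux ler_wpM2r ?rnorm_ge0.
have Wre y : (1 - 2 * q ^+ 2) * rnorm y ^+ 2 <= complex.Re '[W y, y].
  have W2 : rnorm (W y - y) ^+ 2 <= (2 * q * rnorm y) ^+ 2.
    by rewrite ler_pXn2r ?nnegrE ?mulr_ge0 ?rnorm_ge0.
  have Wy : rnorm (W y) = rnorm y := rnorm_opexp_skew y sB.
  move: W2; rewrite rnormB_sqr Wy !exprMn; lra.
have GWG : opexp (A + 'i%C *: B) = G * (W * G).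
  have AiB : (h%:C *: A) * ('i%C *: B) = ('i%C *: B) * (h%:C *: A) by exact: commZ.
  have E1 : opexp ('i%C *: B + h%:C *: A) = W * G := opexpD (esym AiB).
  have E2 : opexp (h%:C *: A + ('i%C *: B + h%:C *: A)) =
      G * opexp ('i%C *: B + h%:C *: A).
    by apply: opexpD; rewrite mulrDl mulrDr AiB.
  transitivity (opexp (h%:C *: A + ('i%C *: B + h%:C *: A))).
    by congr opexp; rewrite addrCA half_double addrC.
  by clearbody G W; rewrite E2 E1.
have G'G x : rnorm x <= opnorm G' * rnorm (G x).
  by rewrite (le_trans _ (opnormP _ _))// -bopME opexpN_l bop_1E.
have sG : adjoint G = G.
  by rewrite adjoint_opexp [adjoint _](self_adjointZ h sA).
pose k := opnorm G' ^+ 2 + 1.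
have k0 : 0 < k by rewrite ltr_wpDl ?sqr_ge0.
exists ((1 - 2 * q ^+ 2) / k) => [|x]; first by rewrite divr_gt0// subr_gt0.
rewrite GWG !bopME adjointP sG (le_trans _ (Wre (G x)))//.
rewrite mulrAC ler_pdivrMr// -mulrA ler_wpM2l ?subr_ge0 ?(ltW q2)// [leRHS]mulrC.
apply: (@le_trans _ _ (opnorm G' ^+ 2 * rnorm (G x) ^+ 2)); last first.
  by rewrite ler_wpM2r ?sqr_ge0// lerDl.
by rewrite -exprMn ler_pXn2r ?nnegrE ?mulr_ge0 ?rnorm_ge0 ?opnorm_ge0.
Qed.

(** One halving step: [V = opexp Y] squares to an operator commuting with [T],
    so the commutator of [V] and [T] anticommutes with [V]. *)
Lemma comm_opexp_half T A B : self_adjoint A -> self_adjoint B -> A * B = B * A ->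
  opnorm B <= 1 -> let Y := A + 'i%C *: B in
  T * opexp (Y + Y) = opexp (Y + Y) * T -> T * opexp Y = opexp Y * T.
Proof.
move=> sA sB AB B1 Y; rewrite opexpD; last by [].
set V := opexp Y => TV.
have [c c0 Vc] := opexp_accretive sA sB AB B1.
suff : V * T - T * V = 0 by move/subr0_eq.
apply: (sylvester_accretive c0 Vc).
by rewrite mulrBr mulrBl opprB !mulrA -TV !mulrA.
Qed.

Lemma comm_opexp_dyadic T A B (k : nat) :
  self_adjoint A -> self_adjoint B -> A * B = B * A -> opnorm B <= 2 ->
  T * opexp (A + 'i%C *: B) = opexp (A + 'i%C *: B) * T ->
  let Y := ((1 / 2 : R) ^+ k)%:C *: (A + 'i%C *: B) in T * opexp Y = opexp Y * T.
Proof.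
move=> sA sB AB B2 TN; elim: k => [|k IH] /=; first by rewrite expr0 scale1r.
pose t : R := (1 / 2) ^+ k.+1.
have t0 : 0 <= t by rewrite exprn_ge0//; lra.
have t1 : t <= 1 / 2.
  by rewrite /t exprS -[leRHS]mulr1 ler_wpM2l ?exprn_ile1//; lra.
have YE : t%:C *: (A + 'i%C *: B) = t%:C *: A + 'i%C *: (t%:C *: B).
  by rewrite scalerDr !scalerA [t%:C * _]mulrC.
rewrite -/t YE; apply: comm_opexp_half; [exact: self_adjointZ..|exact: commZ| |].
  rewrite opnorm_realZ//; have := opnorm_ge0 B; nra.
rewrite -YE; suff -> : t%:C *: (A + 'i%C *: B) + t%:C *: (A + 'i%C *: B) =
  ((1 / 2 : R) ^+ k)%:C *: (A + 'i%C *: B) by [].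
by rewrite -scalerDl -rmorphD /t exprS; congr (_%:C *: _); lra.
Qed.

Lemma expR_remainder_le (y : R) : 0 <= y -> y <= 1 / 2 ->
  expR y - (1 + y) <= 2 * y ^+ 2.
Proof.
move=> y0 y2; have := expR_ge1Dx (- y); rewrite expRN -[X in _ <= X]mul1r.
rewrite ler_pdivlMr ?expR_gt0// => ey; rewrite lerBlDr.
have y1 : 0 < 1 - y by lra.
rewrite -(ler_pM2l y1) (le_trans ey)//.
have -> : (1 - y) * (2 * y ^+ 2 + (1 + y)) = 1 + y ^+ 2 * (1 - 2 * y) by ring.
by rewrite lerDl mulr_ge0 ?sqr_ge0//; lra.
Qed.

(** * Commuting with an operator and with its exponential *)

(** [T] commutes with [N] as soon as it commutes with the exponentials of small
    multiples of [N], since the second order remainder is negligible. *)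
Lemma comm_opexp_small T N :
  (forall k : nat, let Y := ((1 / 2 : R) ^+ k)%:C *: N in T * opexp Y = opexp Y * T) ->
  T * N = N * T.
Proof.
move=> TN; apply/subr0_eq; set Z := _ - _.
pose C := 4 * opnorm T * opnorm N ^+ 2.
have t_cvg0 : (fun k : nat => (1 / 2 : R) ^+ k) @ \oo --> (0 : R).
  by apply: cvg_expr; rewrite ger0_norm; lra.
have small : \forall k \near \oo, (1 / 2 : R) ^+ k * opnorm N <= 1 / 2.
  have : (fun k : nat => (1 / 2 : R) ^+ k * opnorm N) @ \oo --> 0 * opnorm N.
    by apply: cvgM => //; exact: cvg_cst.
  rewrite mul0r => /cvgrPdist_le/(_ (1 / 2)) []; first by lra.
  move=> k0 _ k0P; exists k0 => // k /k0P; rewrite sub0r normrN.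
  by rewrite ger0_norm// mulr_ge0 ?opnorm_ge0// exprn_ge0//; lra.
have cv0 : (fun k : nat => C * (1 / 2 : R) ^+ k) @ \oo --> C * 0.
  by apply: cvgM => //; exact: cvg_cst.
apply/opnorm_eq0P/eqP; rewrite eq_le opnorm_ge0 andbT -[leRHS](mulr0 C).
apply: (cvgr_to_ge cv0); apply: filterS small => k; set t := _ ^+ k => tN.
have t0 : 0 < t by rewrite exprn_gt0//; lra.
have := TN k; rewrite /= -/t; set Y := t%:C *: N => TY.
have YN : opnorm Y = t * opnorm N by rewrite opnorm_realZ// ltW.
pose r := opexp Y - (1 + Y).
have Zr : t%:C *: Z = - (T * r - r * T).
  rewrite /Z scalerBr bop_scalerAr bop_scalerAl -/Y /r.
  rewrite mulrBr mulrBl mulrDr mulrDl mulr1 mul1r TY.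
  by rewrite opprB opprB [RHS]addrC subrKA opprD addrACA subrr add0r.
have rN : opnorm r <= 2 * (t * opnorm N) ^+ 2.
  rewrite -YN (le_trans (opnorm_opexpB1B Y))// expR_remainder_le ?opnorm_ge0//.
  by rewrite YN.
rewrite -(ler_pM2l t0) -opnorm_realZ ?(ltW t0)// Zr opnormN.
rewrite (le_trans (opnormB_le _ _))//.
have T0 := opnorm_ge0 T.
have h1 := le_trans (opnormM_le T r) (ler_wpM2l T0 rN).
have h2 := le_trans (opnormM_le r T) (ler_wpM2r T0 rN).
rewrite (le_trans (lerD h1 h2))// /C le_eqVlt; apply/orP; left; apply/eqP; ring.
Qed.

Lemma normal_cartesian_comm N A B : normal_op N ->
  cartesian_decomposition N A B -> A * B = B * A.
Proof.
move=> nN [sA sB NE]; set I := 'i%C *: B in NE.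
have N'E : adjoint N = A - I.
  rewrite NE adjointD sA /I adjointZ sB.
  have -> : ('i%C : R[i])^* = - 'i%C by apply/eqP; rewrite eq_complex/= oppr0 !eqxx.
  by rewrite scaleNr.
have D0 : 2 *: (I * A - A * I) = 0 :> bop H.
  move: nN; rewrite /normal_op N'E NE => /eqP; rewrite -subr_eq0 => /eqP <-.
  rewrite !mulrDl !mulrDr !mulrN !mulNr scaler_nat mulr2n.
  rewrite !opprD !opprK addrACA [RHS]addrACA [X in _ = X + _]addrACA subrr add0r.
  by rewrite [X in _ = _ + X]addrACA addNr addr0 addrC.
move/eqP: D0; rewrite scaler_eq0 pnatr_eq0/= subr_eq0 /I -bop_scalerAl -bop_scalerAr.
move=> /eqP /scalerI E; apply/esym/E.
by rewrite eq_complex/= oner_eq0 andbF.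
Qed.

(** An operator commutes with [N] whenever it commutes with [opexp N], provided
    the spectrum of the imaginary part of [N] lies in the open interval from [0]
    to [pi]. Subtracting the scalar ['i * pi / 2] from [N] centers this interval
    at [0]. *)
Lemma comm_opexp T N A B : normal_op N -> cartesian_decomposition N A B ->
  spectrum B `<=` [set t%:C | t in `]0, (pi : R)[] ->
  T * opexp N = opexp N * T -> T * N = N * T.
Proof.
move=> nN dN specB TN; have AB := normal_cartesian_comm nN dN.
have [sA sB NE] := dN; pose h : R := pi / 2.
have h0 : 0 < h by rewrite /h divr_gt0 ?pi_gt0.
pose B0 := B + (- h)%:C *: (1 : bop H).
have c1comm (c : R[i]) S : S * (c *: (1 : bop H)) = (c *: (1 : bop H)) * S.
  by rewrite -bop_scalerAl -bop_scalerAr mulr1 mul1r.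
have sB0 : self_adjoint B0.
  by rewrite /self_adjoint adjointD sB adjointZ adjoint1 conj_real.
have AB0 : A * B0 = B0 * A by rewrite mulrDr mulrDl AB c1comm.
have B02 : opnorm B0 <= 2.
  apply: (@le_trans _ _ h); last by rewrite ltW// pihalf_lt2.
  apply: opnorm_le_spectrum => // [|l lB0]; first exact: ltW.
  have /specB[t] : spectrum B (l + h%:C).
    move=> [S SB]; apply: lB0; exists S.
    suff -> : B0 - l *: (1 : bop H) = B - (l + h%:C) *: (1 : bop H) by [].
    by rewrite /B0 rmorphN scaleNr scalerDl opprD -addrA; congr (_ + _); rewrite addrC.
  rewrite /= in_itv/= => /andP[t0 tpi] tE.
  have -> : l = (t - h)%:C by rewrite rmorphB/= tE addrK.
  rewrite normc_def/= expr0n addr0 sqrtr_sqr lecR ler_norml.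
  have : pi = h + h by rewrite /h -splitr.
  by move=> piE; rewrite piE in tpi; apply/andP; split; lra.
pose c : R[i] := 'i%C * (- h)%:C.
have N0E : A + 'i%C *: B0 = N + c *: (1 : bop H).
  by rewrite /B0 scalerDr scalerA NE addrA.
have TN0 : T * opexp (A + 'i%C *: B0) = opexp (A + 'i%C *: B0) * T.
  rewrite N0E opexpD; last exact: c1comm.
  by rewrite mulrA TN -!mulrA (opexp_comm (c1comm c T)).
have := comm_opexp_small (fun k => comm_opexp_dyadic k sA sB0 AB0 B02 TN0).
by rewrite N0E mulrDl mulrDr c1comm => /addIr.
Qed.

End HilbertSpace.

Theorem theorem3 (R : realType) (H : hilbertType R) (sepH : separable H)
    (N M A B C D : bop H)
    (normN : normal_op N) (normM : normal_op M)
    (decN : cartesian_decomposition N A B)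
    (decM : cartesian_decomposition M C D)
    (specB : spectrum B `<=` [set t%:C | t in `]0, (pi : R)[])
    (specD : spectrum D `<=` [set t%:C | t in `]0, (pi : R)[]) :
  opexp M * opexp N = opexp N * opexp M -> M * N = N * M.
Proof.
move=> MN; have := comm_opexp normN decN specB MN => NM.
by have := comm_opexp normM decM specD (esym NM).
Qed.
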